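(* The $0$-assertional logic of $\mathbb{SDM}$ is strongly algebraisable with equivalent variety semantics $\mathbb{SDM}_{\varepsilon}=\mathbb{SK}$ (that is, the class $\mathbb{SDM}_{\varepsilon}$ of reduced algebras of $\mathbb{SDM}$ equals the variety $\mathbb{SK}$, and this is an equivalent algebraic semantics for the logic).
   Context: A bounded involution lattice is an algebra $(L,\wedge,\vee,{}^{\prime},0,1)$ such that $(L,\wedge,\vee,0,1)$ is a bounded lattice, $a^{\prime\prime}=a$, and $a\leq b$ implies $b^{\prime}\leq a^{\prime}$. It is a pseudo-Kleene algebra if $a\wedge a^{\prime}\leq b\vee b^{\prime}$ for all $a,b$. A BZ-lattice is an algebra $\mathbf{L}=(L,\wedge,\vee,{}^{\prime},{}^{\sim},0,1)$ whose reduct without ${}^{\sim}$ is a pseudo-Kleene algebra and such that for all $a,b\in L$: $a\wedge a^{\sim}=0$; $a\leq a^{\sim\sim}$; $a\leq b$ implies $b^{\sim}\leq a^{\sim}$; $a^{\sim\prime}=a^{\sim\sim}$. Write $\Diamond x=x^{\sim\sim}$ and $\square x=x^{\prime\sim}$. A PBZ$^{\ast}$-lattice is a BZ-lattice satisfying $(a\wedge a^{\prime})^{\sim}\leq a^{\sim}\vee\square a$ for all $a$, and which is paraorthomodular: $a\leq b$ and $a^{\prime}\wedge b=0$ imply $a=b$. PBZ$^{\ast}$-lattices form a variety $\mathbb{PBZL}^{\ast}$. $\mathbb{SDM}$ is the subvariety of $\mathbb{PBZL}^{\ast}$ axiomatised relative to it by $(x\wedge y)^{\sim}\approx x^{\sim}\vee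 y^{\sim}$. $\mathbb{SK}$ is the subvariety of $\mathbb{SDM}$ axiomatised relative to it by the identity $x\wedge\Diamond y\leq\square x\vee y$. $\mathbb{PBZL}^{\ast}$ (hence $\mathbb{SDM}$) is $0$-subtractive (there is a binary term $s$ with $s(x,x)\approx 0$ and $s(x,0)\approx x$), so for $\mathbf{A}$ in it there is a largest congruence $\{0\}^{\varepsilon}$ of $\mathbf{A}$ whose $0$-class is $\{0\}$; $\mathbf{A}$ is reduced if $\{0\}^{\varepsilon}$ is the identity relation. For a subvariety $\mathbb{V}$, $\mathbb{V}_{\varepsilon}$ is the class of reduced members of $\mathbb{V}$. The $0$-assertional logic of a variety $\mathbb{V}$ is the consequence relation on terms: $\Gamma\vdash\varphi$ iff for every $\mathbf{A}\in\mathbb{V}$ and every assignment $h$ into $\mathbf{A}$, if $h(\gamma)=0$ for all $\gamma\in\Gamma$ then $h(\varphi)=0$. A logic $\vdash$ is algebraisable (in the sense of Blok and Pigozzi) with a class $\mathbb{K}$ as equivalent algebraic semantics if there are a finite set $\tau(x)$ of equations in one variable and a finite set $\Delta(x,y)$ of formulas in two variables such that $\Gamma\vdash\varphi$ iff $\tau[\Gamma]\models_{\mathbb{K}}\tau(\varphi)$ for all $\Gamma,\varphi$, and $x\approx y$ and $\tau[\Delta(x,y)]$ are interderivable under $\models_{\mathbb{K}}$. It is strongly algebraisable if the equivalent algebraic semantics is a variety (called its equivalent variety semantics). *)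

(* Defs.v *)
From Stdlib Require Import RelationClasses.
From Stdlib Require List.
From mathcomp Require Import all_boot.
Set Implicit Arguments.
Unset Strict Implicit.
Unset Printing Implicit Defensive.

(* Raw algebras of the similarity type (meet, join, ', ~, 0, 1): classes of
   algebras, terms and congruences all refer to this signature, so no lattice
   axiom (nor decidable equality or order) is built into the carrier. *)
Record bz_algebra : Type := BZAlgebra {
  carrier :> Type;
  meet : carrier -> carrier -> carrier;
  join : carrier -> carrier -> carrier;
  kleene : carrier -> carrier;
  brouwer : carrier -> carrier;
  zero : carrier;
  one : carrier
}.
Arguments zero {b}.
Arguments one {b}.

Declare Scope bz_scope.
Delimit Scope bz_scope with BZ.
Notation "x ⊓ y" := (meet x y) (at level 40, left associativity) : bz_scope.
Notation "x ⊔ y" := (join x y) (at level 50, left associativity) : bz_scope.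
Notation "x ^⊥" := (kleene x) (at level 2, format "x ^⊥") : bz_scope.
Notation "x ^∼" := (brouwer x) (at level 2, format "x ^∼") : bz_scope.
Notation "x ⊑ y" := (meet x y = x) (at level 70) : bz_scope.
Local Open Scope bz_scope.

Definition dia (A : bz_algebra) (x : A) : A := x^∼^∼.
Definition box (A : bz_algebra) (x : A) : A := x^⊥^∼.

Definition alg_class := bz_algebra -> Prop.

Record bounded_lattice (A : bz_algebra) : Prop := {
  meet_assoc : associative (@meet A);
  meet_comm : commutative (@meet A);
  join_assoc : associative (@join A);
  join_comm : commutative (@join A);
  meet_join_absorb : forall a b : A, a ⊓ (a ⊔ b) = a;
  join_meet_absorb : forall a b : A, a ⊔ (a ⊓ b) = a;
  zero_least : forall a : A, zero ⊑ a;
  one_greatest : forall a : A, a ⊑ one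
}.

Record bounded_involution_lattice (A : bz_algebra) : Prop := {
  bil_lattice : bounded_lattice A;
  kleene_involutive : forall a : A, a^⊥^⊥ = a;
  kleene_antitone : forall a b : A, a ⊑ b -> b^⊥ ⊑ a^⊥
}.

Record pseudo_kleene (A : bz_algebra) : Prop := {
  pk_bil : bounded_involution_lattice A;
  pk_kleene : forall a b : A, a ⊓ a^⊥ ⊑ b ⊔ b^⊥
}.

Record bz_lattice (A : bz_algebra) : Prop := {
  bz_pk : pseudo_kleene A;
  meet_brouwer : forall a : A, a ⊓ a^∼ = zero;
  le_dia : forall a : A, a ⊑ a^∼^∼;
  brouwer_antitone : forall a b : A, a ⊑ b -> b^∼ ⊑ a^∼;
  brouwer_kleene : forall a : A, a^∼^⊥ = a^∼^∼
}.

Definition paraorthomodular (A : bz_algebra) : Prop :=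
  forall a b : A, a ⊑ b -> a^⊥ ⊓ b = zero -> a = b.

Record PBZL (A : bz_algebra) : Prop := {
  pbz_bz : bz_lattice A;
  pbz_star : forall a : A, (a ⊓ a^⊥)^∼ ⊑ a^∼ ⊔ box a;
  pbz_paraorthomodular : paraorthomodular A
}.

Record SDM (A : bz_algebra) : Prop := {
  sdm_pbz : PBZL A;
  sdm_strong_de_morgan : forall x y : A, (x ⊓ y)^∼ = x^∼ ⊔ y^∼
}.

Record SK (A : bz_algebra) : Prop := {
  sk_sdm : SDM A;
  sk_identity : forall x y : A, x ⊓ dia y ⊑ box x ⊔ y
}.

Record congruence (A : bz_algebra) (th : A -> A -> Prop) : Prop := {
  cong_equiv : Equivalence th;
  cong_meet : forall a b c d, th a b -> th c d -> th (a ⊓ c) (b ⊓ d);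
  cong_join : forall a b c d, th a b -> th c d -> th (a ⊔ c) (b ⊔ d);
  cong_kleene : forall a b, th a b -> th a^⊥ b^⊥;
  cong_brouwer : forall a b, th a b -> th a^∼ b^∼
}.

Definition zero_class_trivial (A : bz_algebra) (th : A -> A -> Prop) : Prop :=
  forall a : A, th a zero <-> a = zero.

(* [is_zero_eps th]: th is {0}^ε. It is a predicate because a largest such
   congruence need not exist outside the subtractive setting. *)
Record is_zero_eps (A : bz_algebra) (th : A -> A -> Prop) : Prop := {
  eps_congruence : congruence th;
  eps_zero_class : zero_class_trivial th;
  eps_largest : forall th' : A -> A -> Prop,
    congruence th' -> zero_class_trivial th' ->
    forall a b, th' a b -> th a b
}.

Definition reduced (A : bz_algebra) : Prop := is_zero_eps (@eq A).

Definition reduced_members (V : alg_class) : alg_class :=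
  fun A => V A /\ reduced A.

Inductive term (X : Type) : Type :=
| Var of X
| Meet of term X & term X
| Join of term X & term X
| Kleene of term X
| Brouwer of term X
| Zero
| One.
Arguments Zero {X}.
Arguments One {X}.

Fixpoint eval (A : bz_algebra) (X : Type) (h : X -> A) (t : term X) : A :=
  match t with
  | Var x => h x
  | Meet s t => eval h s ⊓ eval h t
  | Join s t => eval h s ⊔ eval h t
  | Kleene t => (eval h t)^⊥
  | Brouwer t => (eval h t)^∼
  | Zero => zero
  | One => one
  end.

Fixpoint subst (X Y : Type) (f : X -> term Y) (t : term X) : term Y :=
  match t with
  | Var x => f x
  | Meet s t => Meet (subst f s) (subst f t)
  | Join s t => Join (subst f s) (subst f t)
  | Kleene t => Kleene (subst f t)
  | Brouwer t => Brouwer (subst f t)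
  | Zero => Zero
  | One => One
  end.

Definition formula := term nat.

Definition equation (X : Type) : Type := (term X * term X)%type.

Definition satisfies (A : bz_algebra) (X : Type) (h : X -> A)
  (e : equation X) : Prop := eval h e.1 = eval h e.2.

Definition is_variety (K : alg_class) : Prop :=
  exists E : equation nat -> Prop, forall A : bz_algebra,
    K A <-> (forall e, E e -> forall h : nat -> A, satisfies h e).

Definition logic := (formula -> Prop) -> formula -> Prop.

Definition assertional_logic (V : alg_class) : logic :=
  fun G phi => forall A : bz_algebra, V A -> forall h : nat -> A,
    (forall g, G g -> eval h g = zero) -> eval h phi = zero.

(* [S ⊨_K T], with a set of equations on the right as well. *)
Definition eq_consequence (K : alg_class) (S T : equation nat -> Prop) : Prop :=
  forall A : bz_algebra, K A -> forall h : nat -> A,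
    (forall e, S e -> satisfies h e) -> forall e, T e -> satisfies h e.

(* τ(x) is a finite list of equations over the one-element variable type [unit];
   Δ(x,y) is a finite list of terms over the two-element variable type [bool],
   with [true] standing for x and [false] for y. *)
Definition tau_image (tau : seq (equation unit)) (G : formula -> Prop) :
    equation nat -> Prop :=
  fun e => exists2 p, G p & exists2 q, List.In q tau &
    e = (subst (fun=> p) q.1, subst (fun=> p) q.2).

Definition delta_inst (Delta : seq (term bool)) (s t : formula) :
    formula -> Prop :=
  fun p => exists2 d, List.In d Delta &
    p = subst (fun b : bool => if b then s else t) d.

Definition algebraisable_with (L : logic) (K : alg_class) : Prop :=
  exists (tau : seq (equation unit)) (Delta : seq (term bool)),
    let x := Var 0 in let y := Var 1 in
    [/\ forall (G : formula -> Prop) (phi : formula),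
          L G phi <-> eq_consequence K (tau_image tau G) (tau_image tau (eq phi)),
        eq_consequence K (eq (x, y)) (tau_image tau (delta_inst Delta x y))
      & eq_consequence K (tau_image tau (delta_inst Delta x y)) (eq (x, y))].

Definition strongly_algebraisable_with (L : logic) (K : alg_class) : Prop :=
  is_variety K /\ algebraisable_with L K.

(* Main.v *)
From Stdlib Require Import RelationClasses ProofIrrelevance IndefiniteDescription.
From mathcomp Require Import all_boot.
Require Import Defs.
Set Implicit Arguments.
Unset Strict Implicit.
Unset Printing Implicit Defensive.
Local Open Scope bz_scope.

(** In an algebra of SDM the operations x^∼ and x^⊥^∼ turn meets and joins into
    joins and meets, so "x^∼ = y^∼ and x^⊥^∼ = y^⊥^∼" is a congruence; its
    0-class is {0}.  In a reduced algebra it is therefore the identity, and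
    both sides of x ∧ ◇y = (x ∧ ◇y) ∧ (□x ∨ y) are related by it.
    Conversely, let m = x ∧ y and j = x ∨ y.  In SK the equations
    ◇j ∧ m^∼ = 0 and ◇(m^⊥) ∧ j^⊥^∼ = 0 force ◇j = ◇m and □j = □m by
    paraorthomodularity, whence j = j ∧ ◇m ≤ □j ∨ m = m and x = y.  This makes
    SK reduced and supplies the equivalence formulas.  Completeness of SK for
    the 0-assertional logic of SDM comes from passing to the quotient by the
    congruence above.  That quotient is in SDM since SDM is equational:
    paraorthomodularity amounts to orthomodularity of the closed elements ◇x. *)

(** * Order in bounded lattices *)

Section Lattice.
Context (A : bz_algebra) (L : bounded_lattice A).
Implicit Types a b c : A.

Lemma le_refl a : a ⊑ a.
Proof. by rewrite -{2}(join_meet_absorb L a a) meet_join_absorb. Qed.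

Lemma le_trans b a c : a ⊑ b -> b ⊑ c -> a ⊑ c.
Proof. by move=> ab bc; rewrite -ab -(meet_assoc L) bc. Qed.

Lemma le_anti a b : a ⊑ b -> b ⊑ a -> a = b.
Proof. by move=> ab ba; rewrite -ab (meet_comm L) ba. Qed.

Lemma meet_le_r a b : a ⊓ b ⊑ b.
Proof. by rewrite -(meet_assoc L) le_refl. Qed.

Lemma meet_le_l a b : a ⊓ b ⊑ a.
Proof. by rewrite (meet_comm L a); exact: meet_le_r. Qed.

Lemma le_meet a b c : c ⊑ a -> c ⊑ b -> c ⊑ a ⊓ b.
Proof. by move=> ca cb; rewrite (meet_assoc L) ca. Qed.

Lemma le_join_l a b : a ⊑ a ⊔ b.
Proof. exact: meet_join_absorb. Qed.

Lemma le_join_r a b : b ⊑ a ⊔ b.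
Proof. by rewrite (join_comm L); exact: le_join_l. Qed.

Lemma le_joinE a b : a ⊑ b -> a ⊔ b = b.
Proof.
by move=> <-; rewrite (join_comm L) (meet_comm L) join_meet_absorb.
Qed.

Lemma join_le a b c : a ⊑ c -> b ⊑ c -> a ⊔ b ⊑ c.
Proof.
move=> /le_joinE ac /le_joinE bc.
by rewrite -{1}ac -{1}bc (join_assoc L) meet_join_absorb.
Qed.

Lemma le_zero a : a ⊑ zero -> a = zero.
Proof. by move=> a0; apply: le_anti (zero_least L a). Qed.

Lemma meet_eq_join a b : a ⊓ b = a ⊔ b -> a = b.
Proof.
move=> e; apply: le_anti.
- by apply: le_trans (meet_le_r a b); rewrite e; exact: le_join_l.
- by apply: le_trans (meet_le_l a b); rewrite e; exact: le_join_r.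
Qed.

End Lattice.

(** * Arithmetic of BZ-lattices and their closed elements *)

Lemma bz_bounded_lattice A : bz_lattice A -> bounded_lattice A.
Proof. by case=> [[[]]]. Qed.

Section BZLattice.
Context (A : bz_algebra) (B : bz_lattice A).
Implicit Types a b : A.
Let L := bz_bounded_lattice B.
Let I := pk_bil (bz_pk B).

Lemma kleene_join a b : (a ⊔ b)^⊥ = a^⊥ ⊓ b^⊥.
Proof.
apply: (le_anti L).
  by apply: (le_meet L); apply: (kleene_antitone I);
    [exact: le_join_l | exact: le_join_r].
rewrite -[X in X ⊑ _](kleene_involutive I); apply: (kleene_antitone I).
apply: (join_le L).
- rewrite -[X in X ⊑ _](kleene_involutive I); apply: (kleene_antitone I).
  exact: meet_le_l.
- rewrite -[X in X ⊑ _](kleene_involutive I); apply: (kleene_antitone I).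
  exact: meet_le_r.
Qed.

Lemma kleene_meet a b : (a ⊓ b)^⊥ = a^⊥ ⊔ b^⊥.
Proof.
by rewrite -[RHS](kleene_involutive I) kleene_join !(kleene_involutive I).
Qed.

Lemma brouwer3 a : a^∼^∼^∼ = a^∼.
Proof.
apply: (le_anti L); last exact: le_dia.
by apply: (brouwer_antitone B); exact: le_dia.
Qed.

Lemma box_brouwer a : a^∼^⊥^∼ = a^∼.
Proof. by rewrite (brouwer_kleene B) brouwer3. Qed.

Lemma brouwer_one : (one : A)^∼ = zero.
Proof. by rewrite -(meet_brouwer B one) (meet_comm L) one_greatest. Qed.

Lemma brouwer_zero : (zero : A)^∼ = one.
Proof.
apply: (le_anti L); first exact: one_greatest.
by rewrite -brouwer_one; exact: le_dia.
Qed.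

Lemma brouwer_eq_one a : a^∼ = one -> a = zero.
Proof.
move=> a1; apply: (le_zero L); rewrite -brouwer_one -a1; exact: le_dia.
Qed.

(** The map ∼ is antitone with a ≤ a^∼∼, so it forms a Galois connection with itself and turns joins
    into meets. *)
Lemma brouwer_join a b : (a ⊔ b)^∼ = a^∼ ⊓ b^∼.
Proof.
apply: (le_anti L).
  by apply: (le_meet L); apply: (brouwer_antitone B);
    [exact: le_join_l | exact: le_join_r].
apply: (le_trans L (le_dia B _)); apply: (brouwer_antitone B).
apply: (join_le L).
- apply: (le_trans L (le_dia B _)); apply: (brouwer_antitone B).
  exact: meet_le_l.
- apply: (le_trans L (le_dia B _)); apply: (brouwer_antitone B).
  exact: meet_le_r.
Qed.

Lemma box_le a : box a ⊑ a.
Proof.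
rewrite -[X in _ ⊑ X](kleene_involutive I) -[X in X ⊑ _](kleene_involutive I).
by apply: (kleene_antitone I); rewrite (brouwer_kleene B); exact: le_dia.
Qed.

Lemma box_meet a b : box (a ⊓ b) = box a ⊓ box b.
Proof. by rewrite /box kleene_meet brouwer_join. Qed.

Lemma dia_mono a b : a ⊑ b -> dia a ⊑ dia b.
Proof. by move=> ab; do 2!apply: (brouwer_antitone B). Qed.

Lemma dia_le_closed a b : a ⊑ dia b -> dia a ⊑ dia b.
Proof. by move=> ab; rewrite /dia -[b^∼]brouwer3; exact: dia_mono. Qed.

Lemma dia_meet_closed a b : dia (dia a ⊓ dia b) = dia a ⊓ dia b.
Proof.
apply: (le_anti L); last exact: le_dia.
by apply: (le_meet L); apply: dia_le_closed;
  [exact: meet_le_l | exact: meet_le_r].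
Qed.

(** On closed elements ' agrees with ∼. Hence (p ∨ s)' ∧ ◇b = s^∼ ∧ s = 0, and paraorthomodularity
    applied to p ∨ s ≤ ◇b gives equality. Taking p as a meet makes the orthomodular law an
    identity. *)
Lemma closed_orthomodular (P : paraorthomodular A) a b :
  dia b ⊑ (dia a ⊓ dia b) ⊔ ((dia a ⊓ dia b)^∼ ⊓ dia b).
Proof.
set p := dia a ⊓ dia b; set s := p^∼ ⊓ dia b.
have ps : p ⊔ s = dia b.
  apply: P; first by apply: (join_le L); exact: meet_le_r.
  have pE : p^⊥ = p^∼.
    by rewrite -[p in LHS]dia_meet_closed (brouwer_kleene B) brouwer3.
  have ss : s^∼^∼ = s by rewrite /s -[p^∼]brouwer3; exact: dia_meet_closed.
  rewrite kleene_join pE (meet_comm L (p^∼)).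
  by rewrite -(meet_assoc L) -/s -ss (brouwer_kleene B) brouwer3 ss
    (meet_comm L) (meet_brouwer B).
by rewrite ps; exact: le_refl.
Qed.

(* Under strong De Morgan, a^⊥ ∧ b = 0 says that □a ∨ b^∼ = 1, i.e. that
   □a ≤ a ≤ b ≤ ◇b is an orthogonally trivial pair of closed elements. *)
Lemma paraorthomodular_of_closed
    (S : forall a b : A, (a ⊓ b)^∼ = a^∼ ⊔ b^∼)
    (O : forall a b : A,
      dia b ⊑ (dia a ⊓ dia b) ⊔ ((dia a ⊓ dia b)^∼ ⊓ dia b)) :
  paraorthomodular A.
Proof.
move=> a b ab ab0; apply: (le_anti L) => //.
have bE : dia (a^⊥^∼) = box a by exact: brouwer3.
have lab : box a ⊑ dia b.
  exact: (le_trans L (box_le a) (le_trans L ab (le_dia B b))).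
have := O (a^⊥^∼) b; rewrite bE lab.
have -> : (box a)^∼ ⊓ dia b = zero.
  by rewrite -brouwer_join -S ab0 brouwer_zero brouwer_one.
rewrite (join_comm L) (le_joinE L (zero_least L _)) => ba.
exact: (le_trans L (le_dia B b) (le_trans L ba (box_le a))).
Qed.

(** Since (◇a)' = a^∼, paraorthomodularity applies to ◇a ≤ ◇b and yields ◇a = ◇b. *)
Lemma brouwer_eq_of_disjoint (P : paraorthomodular A) a b :
  a ⊑ b -> dia b ⊓ a^∼ = zero -> a^∼ = b^∼.
Proof.
move=> ab ab0; rewrite -brouwer3 -[b^∼]brouwer3; congr (_^∼).
apply: P; first exact: dia_mono.
by rewrite (brouwer_kleene B) brouwer3 (meet_comm L).
Qed.

End BZLattice.

(** * The modal congruence; reduced SDM algebras lie in SK *)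

Section StrongDeMorgan.
Context (A : bz_algebra) (D : SDM A).
Implicit Types a b c : A.
Let B := pbz_bz (sdm_pbz D).
Let L := bz_bounded_lattice B.
Let I := pk_bil (bz_pk B).
Let S := sdm_strong_de_morgan D.

Lemma box_join a b : box (a ⊔ b) = box a ⊔ box b.
Proof. by rewrite /box (kleene_join B) S. Qed.

Definition modal_eq a b := a^∼ = b^∼ /\ box a = box b.

Lemma modal_eq_congruence : congruence modal_eq.
Proof.
rewrite /modal_eq; split.
- split=> [a|a b [-> ->]|a b c [-> ->]] //.
- by move=> a b c d [e f] [e' f']; rewrite !S !(box_meet B) e f e' f'.
- by move=> a b c d [e f] [e' f']; rewrite !(brouwer_join B) !box_join e f e' f'.
- by move=> a b [e f]; rewrite /box !(kleene_involutive I).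
- by move=> a b [e f]; rewrite e.
Qed.

Lemma modal_eq_zero : zero_class_trivial modal_eq.
Proof.
move=> a; split=> [[e _]|-> //].
by apply: (brouwer_eq_one B); rewrite e (brouwer_zero B).
Qed.

(** The factor □a ∨ b is absorbed under both maps: (□a ∨ b)^∼ ≤ b^∼ ≤ (a ∧ ◇b)^∼, and □(a ∧ ◇b) ≤ □a
    = □□a. *)
Lemma modal_eq_sk a b :
  modal_eq ((a ⊓ dia b) ⊓ (box a ⊔ b)) (a ⊓ dia b).
Proof.
split.
  rewrite S (join_comm L); apply: (le_joinE L).
  rewrite (brouwer_join B) S /dia (brouwer3 B).
  exact: (le_trans L (meet_le_r L _ _) (le_join_r L _ _)).
rewrite !(box_meet B) box_join.
have -> : box (box a) = box a by exact: box_brouwer.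
exact: (le_trans L (meet_le_l L _ _) (le_join_l L _ _)).
Qed.

Lemma reduced_sk : reduced A -> SK A.
Proof.
move=> R; split=> // a b.
exact: (eps_largest R modal_eq_congruence modal_eq_zero (modal_eq_sk a b)).
Qed.

End StrongDeMorgan.

(** * Algebras in SK are reduced *)

Section Kleene.
Context (A : bz_algebra) (K : SK A).
Implicit Types a b : A.
Let D := sk_sdm K.
Let B := pbz_bz (sdm_pbz D).
Let P := pbz_paraorthomodular (sdm_pbz D).
Let L := bz_bounded_lattice B.
Let I := pk_bil (bz_pk B).

(** The first disjointness gives ◇a = ◇b; the second, read for b' ≤ a', gives □a = □b. Then b = b ∧
    ◇a ≤ □b ∨ a = a. *)
Lemma sk_eq_of_le a b : a ⊑ b ->
  dia b ⊓ a^∼ = zero -> dia (a^⊥) ⊓ b^⊥^∼ = zero -> a = b.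
Proof.
move=> ab d0 b0; apply: (le_anti L) => //.
have ed : dia a = dia b.
  by rewrite /dia (brouwer_eq_of_disjoint B P ab d0).
have eb : box b = box a.
  by apply: (brouwer_eq_of_disjoint B P _ b0); exact: (kleene_antitone I).
apply: (le_trans L (b := b ⊓ dia b)); first by apply: (le_meet L);
  [exact: le_refl | exact: le_dia].
rewrite -ed; apply: (le_trans L (sk_identity K b a)); rewrite eb.
by apply: (join_le L); [exact: box_le | exact: le_refl].
Qed.

Lemma sk_eq_of_disjoint a b :
  dia (a ⊔ b) ⊓ (a ⊓ b)^∼ = zero -> dia ((a ⊓ b)^⊥) ⊓ (a ⊔ b)^⊥^∼ = zero ->
  a = b.
Proof.
move=> d0 b0; apply: (meet_eq_join L); apply: sk_eq_of_le => //.
exact: (le_trans L (meet_le_l L _ _) (le_join_l L _ _)).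
Qed.

Lemma sk_disjoint_refl a :
  dia (a ⊔ a) ⊓ (a ⊓ a)^∼ = zero /\ dia ((a ⊓ a)^⊥) ⊓ (a ⊔ a)^⊥^∼ = zero.
Proof.
rewrite (le_refl L) (le_joinE L (le_refl L a)) /dia.
by split; rewrite (meet_comm L) (meet_brouwer B).
Qed.

Lemma sk_reduced : reduced A.
Proof.
split; first by split; [exact: eq_equivalence | | | |]; congruence.
- by move=> a; split.
- move=> th C Z a b ab; case: (cong_equiv C) => rf sy tr.
  (* Replacing a by b relates each term via [th] to its value at (b, b), which is 0. As the 0-class
     is trivial, the terms vanish at (a, b) too. *)
  have bb := sk_disjoint_refl b.
  apply: sk_eq_of_disjoint; apply/Z.
  + rewrite -bb.1; apply: (cong_meet C); do ?apply: (cong_brouwer C).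
    * exact: (cong_join C).
    * exact: (cong_meet C).
  + rewrite -bb.2.
    apply: (cong_meet C); do ?apply: (cong_brouwer C);
      apply: (cong_kleene C); first exact: (cong_meet C).
    exact: (cong_join C).
Qed.

End Kleene.

Lemma reduced_members_SDM A : reduced_members SDM A <-> SK A.
Proof.
split=> [[D R]|K]; first exact: reduced_sk.
by split; [exact: sk_sdm | exact: sk_reduced].
Qed.

(** * Equational bases of SDM and SK *)

Section Equations.

Let x : formula := Var 0.
Let y : formula := Var 1.
Let z : formula := Var 2.
Let tdia (X : Type) (t : term X) := Brouwer (Brouwer t).
Let tbox (X : Type) (t : term X) := Brouwer (Kleene t).
Let tle (s t : formula) : equation nat := (Meet s t, s).

(** Implications become identities: antitonicity compares the image of a join with that of its left
    argument, and the last entry, orthomodularity of closed elements, expresses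
    paraorthomodularity. *)
Definition sdm_axioms : seq (equation nat) := [::
  (Meet x (Meet y z), Meet (Meet x y) z);
  (Meet x y, Meet y x);
  (Join x (Join y z), Join (Join x y) z);
  (Join x y, Join y x);
  (Meet x (Join x y), x);
  (Join x (Meet x y), x);
  tle Zero x;
  tle x One;
  (Kleene (Kleene x), x);
  tle (Kleene (Join x y)) (Kleene x);
  tle (Meet x (Kleene x)) (Join y (Kleene y));
  (Meet x (Brouwer x), Zero);
  tle x (tdia x);
  tle (Brouwer (Join x y)) (Brouwer x);
  (Kleene (Brouwer x), tdia x);
  (Brouwer (Meet x y), Join (Brouwer x) (Brouwer y));
  tle (tdia y) (Join (Meet (tdia x) (tdia y))
    (Meet (Brouwer (Meet (tdia x) (tdia y))) (tdia y)))].

Definition sk_axiom : equation nat := tle (Meet x (tdia y)) (Join (tbox x) y).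

End Equations.

(* Out-of-range indices give the trivial equation 0 ≈ 0. *)
Definition sdm_axiom i : equation nat := nth (Zero, Zero) sdm_axioms i.

Lemma SDM_equational A :
  SDM A <-> forall i (h : nat -> A), satisfies h (sdm_axiom i).
Proof.
split=> [D i h|H].
  have B := pbz_bz (sdm_pbz D); have L := bz_bounded_lattice B.
  have I := pk_bil (bz_pk B).
  case: i => [|i]; first exact: meet_assoc.
  case: i => [|i]; first exact: meet_comm.
  case: i => [|i]; first exact: join_assoc.
  case: i => [|i]; first exact: join_comm.
  case: i => [|i]; first exact: meet_join_absorb.
  case: i => [|i]; first exact: join_meet_absorb.
  case: i => [|i]; first exact: zero_least.
  case: i => [|i]; first exact: one_greatest.
  case: i => [|i]; first exact: kleene_involutive.
  case: i => [|i]; first (by apply: (kleene_antitone I); exact: le_join_l).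
  case: i => [|i]; first exact: (pk_kleene (bz_pk B)).
  case: i => [|i]; first exact: meet_brouwer.
  case: i => [|i]; first exact: le_dia.
  case: i => [|i]; first (by apply: (brouwer_antitone B); exact: le_join_l).
  case: i => [|i]; first exact: brouwer_kleene.
  case: i => [|i]; first exact: sdm_strong_de_morgan.
  case: i => [|i]; first exact: (closed_orthomodular B (pbz_paraorthomodular (sdm_pbz D))).
  by rewrite /sdm_axiom nth_default.
(* Variables 0 and 1 go to a and b, all others to c. *)
pose E i (a b c : A) := H i (nth c [:: a; b]).
have L : bounded_lattice A.
  split=> [a b c|a b|a b c|a b|a b|a b|a|a].
  - exact: (E 0 a b c).
  - exact: (E 1 a b a).
  - exact: (E 2 a b c).
  - exact: (E 3 a b a).
  - exact: (E 4 a b a).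
  - exact: (E 5 a b a).
  - exact: (E 6 a a a).
  - exact: (E 7 a a a).
have B : bz_lattice A.
  split; first split; first split=> //.
  - by move=> a; exact: (E 8 a a a).
  - by move=> a b /(le_joinE L) <-; exact: (E 9 a b a).
  - by move=> a b; exact: (E 10 a b a).
  - by move=> a; exact: (E 11 a a a).
  - by move=> a; exact: (E 12 a a a).
  - by move=> a b /(le_joinE L) <-; exact: (E 13 a b a).
  - by move=> a; exact: (E 14 a a a).
have S : forall a b : A, (a ⊓ b)^∼ = a^∼ ⊔ b^∼.
  by move=> a b; exact: (E 15 a b a).
(* The inequality [pbz_star] is strong De Morgan at a and a'. *)
split=> //; split=> //; first by move=> a; rewrite S; exact: le_refl.
by apply: (paraorthomodular_of_closed B S) => a b; exact: (E 16 a b a).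
Qed.

Lemma is_variety_SK : is_variety SK.
Proof.
exists (fun e => e = sk_axiom \/ exists i, e = sdm_axiom i) => A.
split=> [K e Ee h|H].
  case: Ee => [->|[j ->]]; first exact: (sk_identity K).
  by move: j h; apply/SDM_equational; exact: sk_sdm.
split; first by apply/SDM_equational => i; apply: H; right; exists i.
by move=> a b; exact: (H _ (or_introl erefl) (nth b [:: a])).
Qed.

(** * Homomorphic images *)

Record hom (A B : bz_algebra) (f : A -> B) : Prop := {
  hom_meet : forall a b, f (a ⊓ b) = f a ⊓ f b;
  hom_join : forall a b, f (a ⊔ b) = f a ⊔ f b;
  hom_kleene : forall a, f a^⊥ = (f a)^⊥;
  hom_brouwer : forall a, f a^∼ = (f a)^∼;
  hom_zero : f zero = zero;
  hom_one : f one = one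
}.

Lemma eval_hom (A B : bz_algebra) (f : A -> B) X (h : X -> A) t :
  hom f -> eval (f \o h) t = f (eval h t).
Proof.
case=> fm fj fk fb f0 f1.
by elim: t => //= [s -> t ->|s -> t ->|t ->|t ->].
Qed.

Lemma SDM_quotient (A B : bz_algebra) (f : A -> B) :
  hom f -> (forall b, exists a, f a = b) -> SDM A -> SDM B.
Proof.
move=> fh surj /SDM_equational D; apply/SDM_equational => i h.
(* A choice of preimages lifts assignments into [B] to assignments into [A]. *)
pose g b := proj1_sig (constructive_indefinite_description _ (surj b)).
have fg b : f (g b) = b by rewrite /g; case: constructive_indefinite_description.
have gh t : f (eval (g \o h) t) = eval h t.
  rewrite -eval_hom //.
  by elim: t => //= [s -> t ->|s -> t ->|t ->|t ->].
by rewrite /satisfies -!gh; congr f; exact: D.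
Qed.

(** * The quotient by the modal congruence *)

Section ModalQuotient.
Context (A : bz_algebra) (D : SDM A).
Let B := pbz_bz (sdm_pbz D).
Let I := pk_bil (bz_pk B).

Definition modal_pair (a : A) : A * A := (a^∼, box a).

(** The kernel of [modal_pair] is [modal_eq], so its image models the quotient without equivalence
    classes. *)
Definition modal_carrier : Type := {p : A * A | exists a, p = modal_pair a}.

Definition modal_class (a : A) : modal_carrier :=
  exist _ (modal_pair a) (ex_intro _ a erefl).

Lemma modal_carrier_inj (p q : modal_carrier) : sval p = sval q -> p = q.
Proof. by apply: eq_sig_hprop => ? ? ?; exact: proof_irrelevance. Qed.

Lemma modal_class_surj (p : modal_carrier) : exists a, modal_class a = p.
Proof.
by case: p => p [a pa]; exists a; apply: modal_carrier_inj.
Qed.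

Lemma modal_lift1_proof (F : A * A -> A * A) (f : A -> A) :
  (forall a, F (modal_pair a) = modal_pair (f a)) ->
  forall p : modal_carrier, exists a, F (sval p) = modal_pair a.
Proof. by move=> Ff [p /= [a ->]]; exists (f a). Qed.

Lemma modal_lift2_proof (F : A * A -> A * A -> A * A) (f : A -> A -> A) :
  (forall a b, F (modal_pair a) (modal_pair b) = modal_pair (f a b)) ->
  forall p q : modal_carrier, exists a, F (sval p) (sval q) = modal_pair a.
Proof. by move=> Ff [p /= [a ->]] [q /= [b ->]]; exists (f a b). Qed.

Definition modal_lift1 F f Ff (p : modal_carrier) : modal_carrier :=
  exist _ (F (sval p)) (@modal_lift1_proof F f Ff p).

Definition modal_lift2 F f Ff (p q : modal_carrier) : modal_carrier :=
  exist _ (F (sval p) (sval q)) (@modal_lift2_proof F f Ff p q).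

Lemma modal_pair_meet a b :
  ((modal_pair a).1 ⊔ (modal_pair b).1, (modal_pair a).2 ⊓ (modal_pair b).2) =
  modal_pair (a ⊓ b).
Proof. by rewrite /modal_pair (sdm_strong_de_morgan D) (box_meet B). Qed.

Lemma modal_pair_join a b :
  ((modal_pair a).1 ⊓ (modal_pair b).1, (modal_pair a).2 ⊔ (modal_pair b).2) =
  modal_pair (a ⊔ b).
Proof. by rewrite /modal_pair (brouwer_join B) (box_join D). Qed.

Lemma modal_pair_kleene a :
  ((modal_pair a).2, (modal_pair a).1) = modal_pair a^⊥.
Proof. by rewrite /modal_pair /box (kleene_involutive I). Qed.

Lemma modal_pair_brouwer a :
  ((modal_pair a).1^∼, (modal_pair a).1) = modal_pair a^∼.
Proof. by rewrite /modal_pair /box (box_brouwer B). Qed.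

(** The first coordinate is a value of ∼, so there meet and join trade places; ' swaps coordinates
    because a'^∼ = □a and □(a') = a^∼. *)
Definition modal_quotient : bz_algebra := {|
  carrier := modal_carrier;
  meet := modal_lift2 (F := fun p q => (p.1 ⊔ q.1, p.2 ⊓ q.2)) modal_pair_meet;
  join := modal_lift2 (F := fun p q => (p.1 ⊓ q.1, p.2 ⊔ q.2)) modal_pair_join;
  kleene := modal_lift1 (F := fun p => (p.2, p.1)) modal_pair_kleene;
  brouwer := modal_lift1 (F := fun p => (p.1^∼, p.1)) modal_pair_brouwer;
  zero := modal_class zero;
  one := modal_class one
|}.

Lemma modal_class_hom : hom (modal_class : A -> modal_quotient).
Proof.
split=> // *; apply: modal_carrier_inj => /=.
- by rewrite -modal_pair_meet.
- by rewrite -modal_pair_join.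
- by rewrite -modal_pair_kleene.
- by rewrite -modal_pair_brouwer.
Qed.

Lemma modal_class_eq a b : modal_class a = modal_class b <-> modal_eq a b.
Proof.
split=> [/(congr1 sval) [e f] //|[e f]].
by apply: modal_carrier_inj; rewrite /= /modal_pair e f.
Qed.

Lemma modal_quotient_SK : SK modal_quotient.
Proof.
split; first exact: (SDM_quotient modal_class_hom modal_class_surj D).
move=> p q; case: (modal_class_surj p) (modal_class_surj q) => a <- [b <-].
have [hm hj hk hb _ _] := modal_class_hom.
rewrite /dia /box -!(hk, hb) -!(hm, hj).
by apply/modal_class_eq; exact: modal_eq_sk.
Qed.

End ModalQuotient.

(** * Completeness for SK and algebraisability *)

Lemma assertional_logic_SDM_SK G phi :
  assertional_logic SDM G phi <-> assertional_logic SK G phi.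
Proof.
split=> H A; first by move/sk_sdm; exact: H.
move=> D h Gh; have fh := modal_class_hom D.
(* The 0-class of [modal_eq] is {0}, so [phi] is 0 in [A] once it is 0 in the quotient. *)
apply/(modal_eq_zero D)/modal_class_eq.
rewrite -(eval_hom h phi fh); apply: (H _ (modal_quotient_SK D)) => g /Gh gh.
by rewrite (eval_hom h g fh) gh.
Qed.

Definition sk_tau : seq (equation unit) := [:: (Var tt, Zero)].

(** In SK the terms vanish exactly when x ∨ y and x ∧ y have the same ◇ and the same □,
    respectively. *)
Definition sk_delta : seq (term bool) :=
  let x := Var true in let y := Var false in
  [:: Meet (Brouwer (Brouwer (Join x y))) (Brouwer (Meet x y));
      Meet (Brouwer (Brouwer (Kleene (Meet x y)))) (Brouwer (Kleene (Join x y)))].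

Lemma sk_tauE (A : bz_algebra) (h : nat -> A) (G : formula -> Prop) :
  (forall e, tau_image sk_tau G e -> satisfies h e) <->
  (forall g, G g -> eval h g = zero).
Proof.
split=> [H g Gg|H e [g Gg [q [<-|[]] ->]]]; last exact: H.
by apply: (H (g, Zero)); exists g => //; exists (Var tt, Zero) => //; left.
Qed.

Lemma algebraisable_SDM_SK : algebraisable_with (assertional_logic SDM) SK.
Proof.
exists sk_tau, sk_delta; split.
- move=> G phi; rewrite assertional_logic_SDM_SK; split=> H A K h.
  + by move/sk_tauE => Gh; apply/sk_tauE => _ <-; exact: H Gh.
  + move=> Gh; apply: (proj1 (sk_tauE h (eq phi)) _ phi erefl).
    by apply: H => //; exact/sk_tauE.
- move=> A K h H; apply/sk_tauE.
  have xy : h 0 = h 1 by exact: (H (Var 0, Var 1) erefl).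
  have [d0 b0] := sk_disjoint_refl K (h 1).
  by move=> _ [d [<-|[<-|[]]] ->] /=; rewrite xy.
- move=> A K h /sk_tauE H _ <-.
  apply: (sk_eq_of_disjoint K).
  + exact: (H _ (ex_intro2 _ _ _ (or_introl erefl) erefl)).
  + exact: (H _ (ex_intro2 _ _ _ (or_intror (or_introl erefl)) erefl)).
Qed.

(** Classes are predicates, so their pointwise equivalence has to be transported through each
    clause. *)
Lemma strongly_algebraisable_ext (L : logic) (K K' : alg_class) :
  (forall A, K A <-> K' A) ->
  strongly_algebraisable_with L K' -> strongly_algebraisable_with L K.
Proof.
move=> KK [[E HE] [tau [Delta [H1 H2 H3]]]].
have C S T : eq_consequence K S T <-> eq_consequence K' S T.
  by split=> H A /KK; exact: H.
split; first by exists E => A; rewrite KK.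
by exists tau, Delta; split=> [G phi||]; rewrite ?C.
Qed.

Theorem theorem53 :
  (forall A : bz_algebra, reduced_members SDM A <-> SK A) /\
  strongly_algebraisable_with (assertional_logic SDM) (reduced_members SDM).
Proof.
split; first exact: reduced_members_SDM.
apply: (strongly_algebraisable_ext reduced_members_SDM).
by split; [exact: is_variety_SK | exact: algebraisable_SDM_SK].
Qed.
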